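(* Let $N\in\mathbb{N}$ and let $0\le t_1<t_2<\cdots<t_N$ be real sampling times. (i) (SS kernel) Let $\rho\in(0,1)$ and let $K^{\mathrm{SS}}\in\mathbb{R}^{N\times N}$ have entries $$K^{\mathrm{SS}}(i,j)=\frac{\rho^{t_i+t_j+\max\{t_i,t_j\}}}{2}-\frac{\rho^{3\max\{t_i,t_j\}}}{6}.$$ Then $K^{\mathrm{SS}}\in\mathcal{S}_{N,2}$, and it has the Givens-vector representation $$\boldsymbol c_i^T=\begin{bmatrix}\dfrac{-\rho^{3t_i}}{\sqrt{\sum_{j=i}^N\rho^{6t_j}}} & \dfrac{\rho^{2t_i}}{\sqrt{\sum_{j=i}^N\rho^{4t_j}}}\end{bmatrix},$$ $$\boldsymbol s_i^T=\begin{bmatrix}\dfrac{(-1)^{\mathbf 1(i=N-1)}\sqrt{\sum_{j=i+1}^N\rho^{6t_j}}}{\sqrt{\sum_{j=i}^N\rho^{6t_j}}} & \dfrac{\sqrt{\sum_{j=i+1}^N\rho^{4t_j}}}{\sqrt{\sum_{j=i}^N\rho^{4t_j}}}\end{bmatrix},$$ $$\hat{\boldsymbol\nu}_\ell^T=\begin{bmatrix}\dfrac{(-1)^{\mathbf 1(\ell=N)}}{6}\sqrt{\sum_{j=\ell}^N\rho^{6t_j}} & \dfrac{\rho^{t_\ell}}{2}\sqrt{\sum_{j=\ell}^N\rho^{4t_j}}\end{bmatrix},$$ for $i=1,\dots,N-1$ and $\ell=1,\dots,N$. (ii) (DC kernel) Let $\lambda\in(0,1]$, $\rho\in(0,1)$,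 and let $K^{\mathrm{DC}}\in\mathbb{R}^{N\times N}$ have entries $K^{\mathrm{DC}}(i,j)=\lambda^{t_i+t_j}\rho^{|t_i-t_j|}$. Then $K^{\mathrm{DC}}\in\mathcal{S}_{N,1}$, and it has the Givens-vector representation $$c_i=\frac{(\lambda\rho)^{t_i}}{\sqrt{\sum_{j=i}^N(\lambda\rho)^{2t_j}}},\qquad s_i=\frac{\sqrt{\sum_{j=i+1}^N(\lambda\rho)^{2t_j}}}{\sqrt{\sum_{j=i}^N(\lambda\rho)^{2t_j}}},\qquad \hat\nu_\ell=\Big(\frac{\lambda}{\rho}\Big)^{t_\ell}\sqrt{\sum_{j=\ell}^N(\lambda\rho)^{2t_j}},$$ for $i=1,\dots,N-1$ and $\ell=1,\dots,N$. (iii) (TC kernel) For $\rho\in(0,1)$, the matrix $K^{\mathrm{TC}}\in\mathbb{R}^{N\times N}$ with entries $K^{\mathrm{TC}}(i,j)=\rho^{t_i+t_j+|t_i-t_j|}$ belongs to $\mathcal{S}_{N,1}$, and setting $\lambda=\rho$ in the formulas of (ii) gives a Givens-vector representation of it.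
   Context: $\mathbf 1(\cdot)$ is the indicator function. Definition of $\mathcal{S}_{N,p}$: a symmetric matrix $A\in\mathbb{R}^{N\times N}$ is $p$-semiseparable ($A\in\mathcal{S}_{N,p}$) if $\operatorname{rank}(A(i:N,1:i))\le p$ for all $i=1,\dots,N$, with equality $\operatorname{rank}(A(i:N,1:i))=p$ for at least one $i$. Here $A(i:N,1:i)$ is the submatrix of rows $i,\dots,N$ and columns $1,\dots,i$. Givens-vector representation (GvR): vectors $\boldsymbol c_i,\boldsymbol s_i,\hat{\boldsymbol\nu}_i\in\mathbb{R}^p$ ($i=1,\dots,N$), with components $c_{i,k},s_{i,k},\hat\nu_{i,k}$, form a GvR of a symmetric $A\in\mathbb{R}^{N\times N}$ if $c_{i,k}^2+s_{i,k}^2=1$ for all $i\le N-1$ and $k\le p$, and, with $S_i=\operatorname{diag}(\boldsymbol s_i)\in\mathbb{R}^{p\times p}$, $$A(i,j)=\boldsymbol c_i^T\,S_{i-1}S_{i-2}\cdots S_j\,\hat{\boldsymbol\nu}_j\quad\text{for }1\le j\le i\le N,$$ where the product is $I_p$ when $i=j$ (the entries above the diagonal are given by symmetry). By convention $c_{N,k}=1$ and $s_{N,k}=0$ for all $k$, so $\boldsymbol c_i,\boldsymbol s_i$ need only be specified for $i\le N-1$. For $p=1$ one writes $c_i,s_i,\hat\nu_i$ for the scalars.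
   Formalization: The membership of K^SS in S_{N,2} in part (i) is stated only for N ≥ 3; for N = 1, 2 it is false, since every block A(i:N,1:i) then has a single row or column and so cannot have rank 2. *)

(* Defs.v *)
From HB Require Import structures.
From mathcomp Require Import all_boot all_order all_algebra.
From mathcomp Require Import all_classical all_reals all_analysis.
Set Implicit Arguments.
Unset Strict Implicit.
Unset Printing Implicit Defensive.
Import Order.TTheory GRing.Theory Num.Theory.
Local Open Scope ring_scope.

(* All indices are 0-based: the ordinal i : 'I_N stands for the index i + 1
   of the usual 1-based notation, so the last index is the i with i.+1 = N. *)

Section Semiseparable.
Variables (R : fieldType) (N : nat).

Lemma shift_ord_proof (i : 'I_N) (a : 'I_(N - i)) : (i + a < N)%N.
Proof. by rewrite -ltn_subRL. Qed.

Definition shift_ord (i : 'I_N) (a : 'I_(N - i)) : 'I_N :=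
  Ordinal (shift_ord_proof a).

(* A(i:N, 1:i); both blocks of indices contain i. *)
Definition lower_block (A : 'M[R]_N) (i : 'I_N) : 'M[R]_(N - i, i.+1) :=
  mxsub (@shift_ord i) (widen_ord (ltn_ord i)) A.

(* The last clause requires a block with at least p rows and p columns, hence
   2 p <= N + 1: no matrix is 2-semiseparable when N <= 2. *)
Definition semiseparable (p : nat) (A : 'M[R]_N) : Prop :=
  [/\ A^T = A,
      forall i : 'I_N, (\rank (lower_block A i) <= p)%N
    & exists i : 'I_N, \rank (lower_block A i) = p].

End Semiseparable.

Section Givens.
Variables (R : fieldType) (N p : nat).

(* S_{i-1} S_{i-2} ... S_j, the identity when i = j. *)
Definition givens_prod (s : 'I_N -> 'cV[R]_p) (i j : 'I_N) : 'M[R]_p :=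
  \big[mulmx/1%:M]_(k <- rev (enum 'I_N) | (j <= k < i)%N) diag_mx (s k)^T.

Definition is_GvR (A : 'M[R]_N) (c s nu : 'I_N -> 'cV[R]_p) : Prop :=
  [/\ A^T = A,
      forall i : 'I_N, i.+1 = N -> forall k, c i k 0 = 1 /\ s i k 0 = 0,
      forall i : 'I_N, (i.+1 < N)%N ->
        forall k, c i k 0 ^+ 2 + s i k 0 ^+ 2 = 1
    & forall i j : 'I_N, (j <= i)%N ->
        A i j = ((c i)^T *m givens_prod s i j *m nu j) 0 0].

(* Extends vectors specified for all indices but the last one by the constant
   vector of value a at the last index; the value of f there is ignored. *)
Definition with_last (a : R) (f : 'I_N -> 'cV[R]_p) (i : 'I_N) : 'cV[R]_p :=
  if i.+1 == N then const_mx a else f i.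

End Givens.

Definition col2 (R : fieldType) (a b : R) : 'cV[R]_2 :=
  \col_(k < 2) if k == 0 then a else b.

Section Kernels.
Variables (R : realType) (N : nat) (t : 'I_N -> R).

Definition SS_kernel (rho : R) : 'M[R]_N :=
  \matrix_(i, j) (rho `^ (t i + t j + Num.max (t i) (t j)) / 2
                  - rho `^ (3 * Num.max (t i) (t j)) / 6).

Definition DC_kernel (lambda rho : R) : 'M[R]_N :=
  \matrix_(i, j) (lambda `^ (t i + t j) * rho `^ `|t i - t j|).

Definition TC_kernel (rho : R) : 'M[R]_N :=
  \matrix_(i, j) rho `^ (t i + t j + `|t i - t j|).

(* sqrt (\sum_{j >= i} x^(m t_j)); the index i is a natural number so that
   i.+1 may be used as the lower bound of the sum. *)
Definition tail_norm (x m : R) (i : nat) : R :=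
  Num.sqrt (\sum_(j < N | (i <= j)%N) x `^ (m * t j)).

Definition SS_c (rho : R) : 'I_N -> 'cV[R]_2 :=
  with_last 1 (fun i =>
    col2 (- rho `^ (3 * t i) / tail_norm rho 6 i)
         (rho `^ (2 * t i) / tail_norm rho 4 i)).

Definition SS_s (rho : R) : 'I_N -> 'cV[R]_2 :=
  with_last 0 (fun i =>
    col2 ((-1) ^+ (i.+2 == N) * tail_norm rho 6 i.+1 / tail_norm rho 6 i)
         (tail_norm rho 4 i.+1 / tail_norm rho 4 i)).

Definition SS_nu (rho : R) (l : 'I_N) : 'cV[R]_2 :=
  col2 ((-1) ^+ (l.+1 == N) / 6 * tail_norm rho 6 l)
       (rho `^ t l / 2 * tail_norm rho 4 l).

Definition DC_c (lambda rho : R) : 'I_N -> 'cV[R]_1 :=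
  with_last 1 (fun i =>
    const_mx ((lambda * rho) `^ t i / tail_norm (lambda * rho) 2 i)).

Definition DC_s (lambda rho : R) : 'I_N -> 'cV[R]_1 :=
  with_last 0 (fun i =>
    const_mx (tail_norm (lambda * rho) 2 i.+1 / tail_norm (lambda * rho) 2 i)).

Definition DC_nu (lambda rho : R) (l : 'I_N) : 'cV[R]_1 :=
  const_mx ((lambda / rho) `^ t l * tail_norm (lambda * rho) 2 l).

End Kernels.

(* Main.v *)
Require Import Defs.
From HB Require Import structures.
From mathcomp Require Import all_boot all_order all_algebra.
From mathcomp Require Import all_classical all_reals all_analysis.
From mathcomp Require Import ring.
(* On and below the diagonal each kernel is a sum of p separable terms,
   A(i,j) = \sum_k u_{i,k} v_{j,k}, so the lower blocks factor through
   dimension p and a nonzero p x p minor inside one of them gives equality.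
   If g_{i,k}^2 = u_{i,k}^2 + g_{i+1,k}^2 and g_{N,k} = u_{N,k}, then c = u / g,
   s_i = g_{i+1} / g_i and nu = v g form a GvR, because the product
   s_{i-1} ... s_j telescopes to g_i / g_j. *)

Set Implicit Arguments.
Unset Strict Implicit.
Unset Printing Implicit Defensive.
Import Order.TTheory GRing.Theory Num.Theory.
Local Open Scope ring_scope.

(** * Ranks and minors of submatrices *)

(** Select columns first, then rows: the selected rows lie in the row space, and transposing gives
    the same for columns. *)
Lemma mxrank_mxsub (F : fieldType) (m n m' n' : nat)
    (f : 'I_m' -> 'I_m) (g : 'I_n' -> 'I_n) (A : 'M[F]_(m, n)) :
  (\rank (mxsub f g A) <= \rank A)%N.
Proof.
have -> : mxsub f g A = rowsub f (colsub g A).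
  by apply/matrixP=> i j; rewrite !mxE.
apply: leq_trans (mxrankS (rowsub_sub f _)) _.
have -> : colsub g A = (rowsub g A^T)^T by apply/matrixP=> i j; rewrite !mxE.
by rewrite mxrank_tr -[leqRHS]mxrank_tr mxrankS // rowsub_sub.
Qed.

Lemma det_mx2 (F : comNzRingType) (A : 'M[F]_2) :
  \det A = A 0 0 * A 1 1 - A 0 1 * A 1 0.
Proof.
rewrite (expand_det_row _ 0) !big_ord_recl big_ord0 addr0 /cofactor !det_mx11.
rewrite !mxE /= expr0 expr1 mul1r mulN1r mulrN.
by congr (_ * A _ _ - A _ _ * A _ _); apply/val_inj.
Qed.

(** * Symmetric matrices with a separable lower triangle *)

Section Generators.
Variables (F : fieldType) (N p : nat) (A : 'M[F]_N).
Variables u v : 'I_N -> 'I_p -> F.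
Hypothesis A_sym : A^T = A.
Hypothesis A_gen : forall i j : 'I_N, (j <= i)%N ->
  A i j = \sum_k u i k * v j k.

Lemma mxrank_lower_block (i : 'I_N) : (\rank (lower_block A i) <= p)%N.
Proof.
have -> : lower_block A i =
    (\matrix_(a, k) u (shift_ord a) k) *m
    (\matrix_(k, b) v (widen_ord (ltn_ord i) b) k).
  apply/matrixP=> a b; rewrite !mxE A_gen /=.
    by apply: eq_bigr => k _; rewrite !mxE.
  (* Inside the block [b <= i <= i + a], so every entry lies on or below the diagonal. *)
  by rewrite (leq_trans _ (leq_addr _ _)) // -ltnS.
exact: leq_trans (mxrankM_maxl _ _) (rank_leq_col _).
Qed.

Lemma semiseparable_generators (i0 : 'I_N) (f g : 'I_p -> 'I_N) :
    (forall k, g k <= i0 <= f k)%N -> \det (mxsub f g A) != 0 ->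
  semiseparable p A.
Proof.
move=> fg det_neq0; split=> //; first exact: mxrank_lower_block.
exists i0; apply/eqP; rewrite eqn_leq mxrank_lower_block /=.
have fP k : (f k - i0 < N - i0)%N by rewrite ltn_sub2r.
have gP k : (g k < i0.+1)%N by case/andP: (fg k).
(* The invertible minor is re-indexed inside the block at [i0]: row [f k] becomes [f k - i0],
   columns keep their index. *)
have -> : p = \rank (mxsub (fun k => Ordinal (fP k))
    (fun k => Ordinal (gP k)) (lower_block A i0)).
  rewrite mxrank_unit // unitmxE unitfE; move: det_neq0; congr (\det _ != 0).
  apply/matrixP=> a b; rewrite !mxE; congr (A _ _); apply/val_inj => //=.
  by rewrite subnKC //; case/andP: (fg a).
exact: mxrank_mxsub.
Qed.

(** Diagonal matrices multiply entrywise, and scalars commute, so the decreasing order of the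
    factors is immaterial. *)
Lemma givens_prodE (s : 'I_N -> 'cV[F]_p) (i j : 'I_N) :
  givens_prod s i j = diag_mx (\row_a \prod_(k < N | (j <= k < i)%N) s k a 0).
Proof.
have -> : \row_a \prod_(k < N | (j <= k < i)%N) s k a 0 =
    \row_a \prod_(k <- rev (enum 'I_N) | (j <= k < i)%N) s k a 0.
  apply/rowP=> a; rewrite !mxE.
  by rewrite [RHS](perm_big (enum 'I_N)) ?perm_rev // big_enum_cond.
rewrite /givens_prod; elim: (rev _) => [|k r IHr].
  rewrite big_nil -diag_const_mx; congr diag_mx.
  by apply/rowP=> a; rewrite !mxE big_nil.
rewrite big_cons {}IHr; case: ifP => hk.
  rewrite mulmx_diag; congr diag_mx; apply/rowP=> a.
  by rewrite !mxE big_cons hk.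
by congr diag_mx; apply/rowP=> a; rewrite !mxE big_cons hk.
Qed.

(** Indexing [g] by [nat] lets [g i.+1] be written for every [i]. No sign is imposed on [g], so it
    can follow a negative [u] at the last index. *)
Lemma GvR_generators (g : nat -> 'I_p -> F) (c s nu : 'I_N -> 'cV[F]_p) :
    (forall (i : 'I_N) k, g i k != 0) ->
    (forall (i : 'I_N) k, (i.+1 < N)%N ->
      g i k ^+ 2 = u i k ^+ 2 + g i.+1 k ^+ 2) ->
    (forall (i : 'I_N) k, i.+1 = N -> g i k = u i k) ->
    (forall i k, c i k 0 = if i.+1 == N then 1 else u i k / g i k) ->
    (forall i k, s i k 0 = if i.+1 == N then 0 else g i.+1 k / g i k) ->
    (forall j k, nu j k 0 = v j k * g j k) ->
  is_GvR A c s nu.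
Proof.
move=> g_neq0 g_sqr g_last cE sE nuE; split=> //.
- by move=> i iN k; rewrite cE sE iN eqxx.
- move=> i iN k; rewrite cE sE ltn_eqF // !expr_div_n -mulrDl -g_sqr //.
  by rewrite divff // expf_neq0.
move=> i j le_ji; rewrite A_gen // mxE; apply: eq_bigr => k _.
(* The conventional value 1 at the last index agrees with this quotient, since [g] and [u] coincide
   there. *)
have cE' : c i k 0 = u i k / g i k.
  by rewrite cE; case: eqP => // iN; rewrite -g_last // divff.
rewrite givens_prodE mul_mx_diag !mxE cE' nuE.
have -> : \prod_(l < N | (j <= l < i)%N) s l k 0 = g i k / g j k.
  (* Every factor has [l < i < N], so the default value 0 of [s] at the last index never enters. *)
  transitivity (\prod_(l < N | (j <= l < i)%N) (g l.+1 k / g l k)).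
    apply: eq_bigr => l /andP[_ li]; rewrite sE ltn_eqF //.
    exact: leq_ltn_trans (ltn_ord i).
  rewrite (eq_bigl (fun l : 'I_N => (j <= l)%N && (l < i)%N)) //.
  rewrite -(big_ord_widen_cond N (fun l => j <= l)%N
    (fun l => g l.+1 k / g l k)); last exact: ltnW.
  transitivity (\prod_(j <= l < i) (g l.+1 k / g l k)).
    by rewrite big_geq_mkord.
  (* On the diagonal the product is empty; strictly below it, it telescopes. *)
  move: le_ji; rewrite leq_eqVlt => /predU1P[->|lt_ji].
    by rewrite big_geq // divff.
  rewrite telescope_prodf // => l /andP[_ li].
  exact: (g_neq0 (Ordinal (ltn_trans li (ltn_ord i)))).
have := g_neq0 i k; have := g_neq0 j k => gj gi.
by field; rewrite gi gj.
Qed.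

End Generators.

(** * Recursion and positivity of the tail norms *)

Section Tail.
Variables (R : realType) (N : nat) (t : 'I_N -> R) (x m : R).
Hypothesis x_gt0 : 0 < x.

(** Splitting off the term of index [i] gives the recursion required of [g]. *)
Lemma tail_norm_sqr (i : 'I_N) :
  tail_norm t x m i ^+ 2 = x `^ (m * t i) + tail_norm t x m i.+1 ^+ 2.
Proof.
rewrite !sqr_sqrtr; try by apply: sumr_ge0 => j _; exact: powR_ge0.
rewrite (bigD1 i) //=; congr (_ + _); apply: eq_bigl => j.
by rewrite ltn_neqAle andbC eq_sym.
Qed.

Lemma tail_norm_gt0 (i : 'I_N) : 0 < tail_norm t x m i.
Proof.
rewrite lt_neqAle sqrtr_ge0 andbT eq_sym -sqrf_eq0 tail_norm_sqr.
by rewrite gt_eqF // ltr_pwDl ?powR_gt0 // sqr_ge0.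
Qed.

Lemma tail_norm_last (i : 'I_N) (y : R) : i.+1 = N -> 0 <= y ->
  x `^ (m * t i) = y ^+ 2 -> tail_norm t x m i = y.
Proof.
move=> iN y_ge0 xE; apply/eqP; rewrite -(@eqrXn2 _ 2) ?sqrtr_ge0 //.
(* No index follows the last one, so the remaining tail is an empty sum. *)
rewrite tail_norm_sqr xE [X in _ + X ^+ 2](_ : _ = 0).
  by rewrite expr0n addr0.
by rewrite /tail_norm big_pred0 ?sqrtr0 // => j; rewrite iN leqNgt ltn_ord.
Qed.

End Tail.

(** * Real powers of a positive base *)

Section PowR.
Variable R : realType.
Implicit Types x y r s : R.

Lemma powRD_gt0 x r s : 0 < x -> x `^ (r + s) = x `^ r * x `^ s.
Proof. by move=> x_gt0; rewrite powRD // (gt_eqF x_gt0) implybT. Qed.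

Lemma powR_mulnl x (n : nat) r : 0 < x -> x `^ (n%:R * r) = (x `^ r) ^+ n.
Proof. by move=> x_gt0; rewrite mulrC powRrM powR_mulrn // powR_ge0. Qed.

Lemma powRV x r : 0 < x -> x^-1 `^ r = (x `^ r)^-1.
Proof.
by move=> x_gt0; rewrite -powRN -(powR_inv1 (ltW x_gt0)) -powRrM mulN1r.
Qed.

(** Logarithms turn equal powers into [r * ln x = s * ln x], where [ln x < 0]. *)
Lemma powR_inj_exp x : 0 < x < 1 -> injective (powR x).
Proof.
move=> x01 r s /(congr1 (@ln R)); rewrite !ln_powR => /mulIf; apply.
by rewrite lt_eqF // ln_lt0.
Qed.

End PowR.

Section Kernels.
Variables (R : realType) (N : nat) (t : 'I_N -> R).
Hypothesis t_incr : forall i j : 'I_N, (i < j)%N -> t i < t j.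

Lemma le_times (i j : 'I_N) : (j <= i)%N -> t j <= t i.
Proof.
rewrite leq_eqVlt => /predU1P[/val_inj-> //|/t_incr]; exact: ltW.
Qed.

(** * The SS kernel *)

Section SS.
Variable rho : R.
Hypothesis rho01 : 0 < rho < 1.

Let rho_gt0 : 0 < rho. Proof. by case/andP: rho01. Qed.

Let r (i : 'I_N) : R := rho `^ t i.

Lemma SS_kernel_sym : (SS_kernel t rho)^T = SS_kernel t rho.
Proof.
by apply/matrixP=> i j; rewrite !mxE maxC [t j + t i]addrC.
Qed.

Lemma SS_kernelE (i j : 'I_N) : (j <= i)%N ->
  SS_kernel t rho i j = r i ^+ 2 * r j / 2 - r i ^+ 3 / 6.
Proof.
move=> /le_times le_ji; rewrite mxE max_l // !powRD_gt0 // powR_mulnl //.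
by rewrite /r; field.
Qed.

(** The two terms of the kernel below the diagonal; the minus sign goes to [u], as in the first
    entry of [SS_c]. *)
Let u (i : 'I_N) (k : 'I_2) : R := if k == 0 then - r i ^+ 3 else r i ^+ 2.
Let v (j : 'I_N) (k : 'I_2) : R := if k == 0 then 6^-1 else r j / 2.

Let SS_gen (i j : 'I_N) : (j <= i)%N ->
  SS_kernel t rho i j = \sum_k u i k * v j k.
Proof.
move=> le_ji; rewrite SS_kernelE // !big_ord_recl big_ord0 /u /v /=.
by field.
Qed.

Let r_sub_neq0 (i j : 'I_N) : (i < j)%N -> r i - r j != 0.
Proof.
move=> /t_incr lt_ij; rewrite subr_eq0; apply/eqP=> /(powR_inj_exp rho01) tij.
by rewrite tij ltxx in lt_ij.
Qed.

Lemma SS_semiseparable : (3 <= N)%N -> semiseparable 2 (SS_kernel t rho).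
Proof.
move=> N_ge3.
(* The minor has rows 1, 2 and columns 0, 1, within the block at index 1; row 2 exists because
   [3 <= N]. *)
have fP (k : 'I_2) : (k.+1 < N)%N by exact: leq_ltn_trans N_ge3.
have gP (k : 'I_2) : (k < N)%N by apply: ltnW.
apply: (semiseparable_generators SS_kernel_sym SS_gen (i0 := Ordinal (fP 0))
  (f := fun k => Ordinal (fP k)) (g := fun k => Ordinal (gP k))).
  by move=> k /=; rewrite -ltnS ltn_ord.
rewrite det_mx2 ![mxsub _ _ _ _ _]mxE !SS_kernelE //.
set a := r (Ordinal (gP 0)); set b := r (Ordinal (fP 0)).
set c := r (Ordinal (fP 1)).
have -> : r (Ordinal (gP 1)) = b by congr r; apply/val_inj.
(* Row 1 and column 1 share the value [b], so the minor factors; distinct times make both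
   differences nonzero. *)
rewrite [X in X != 0](_ : _ = b ^+ 2 * c ^+ 2 * (a - b) * (b - c) / 12).
  by rewrite !mulf_neq0 ?expf_neq0 ?r_sub_neq0 ?gt_eqF ?powR_gt0.
by field.
Qed.

(* The sign (-1)^(i = N) makes g_N equal to the first generator at N, which is
   negative. *)
Lemma SS_GvR :
  is_GvR (SS_kernel t rho) (SS_c t rho) (SS_s t rho) (SS_nu t rho).
Proof.
pose g (i : nat) (k : 'I_2) : R :=
  if k == 0 then (-1) ^+ (i.+1 == N) * tail_norm t rho 6 i
  else tail_norm t rho 4 i.
have T_neq0 m (i : 'I_N) : tail_norm t rho m i != 0.
  by rewrite gt_eqF ?tail_norm_gt0.
apply: (GvR_generators SS_kernel_sym SS_gen (g := g)).
- move=> i k; rewrite /g; case: ifP => // _.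
  by rewrite mulf_neq0 // signr_eq0.
- move=> i k iN; rewrite /g /u; case: ifP => _; last first.
    by rewrite tail_norm_sqr // powR_mulnl // -exprM.
  rewrite !exprMn !sqrr_sign !mul1r tail_norm_sqr // powR_mulnl //.
  by rewrite sqrrN -exprM.
- move=> i k iN; rewrite /g /u iN eqxx expr1 mulN1r; case: ifP => _.
    congr (- _); apply: tail_norm_last => //.
      by rewrite exprn_ge0 ?powR_ge0.
    by rewrite powR_mulnl // -exprM.
  apply: tail_norm_last => //; first exact: sqr_ge0.
  by rewrite powR_mulnl // -exprM.
- move=> i k; rewrite /SS_c /with_last /g /u; case: eqP => iN; rewrite !mxE //.
  by case: ifP => _; rewrite ?mul1r powR_mulnl.
(* Before the last index [g i] carries no sign, so the sign in [SS_s] is that of [g i.+1]. *)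
- move=> i k; rewrite /SS_s /with_last /g; case: eqP => iN; rewrite !mxE //.
  by case: ifP => _; rewrite ?mul1r.
move=> j k; rewrite /SS_nu !mxE /v /g; case: ifP => _ //.
by rewrite mulrCA mulrA.
Qed.

End SS.

(** * The DC kernel, and the TC kernel as its case [lambda = rho] *)

Section DC.
Variables lambda rho : R.
Hypotheses (lambda_gt0 : 0 < lambda) (rho_gt0 : 0 < rho).

Let lambdarho_gt0 : 0 < lambda * rho. Proof. exact: mulr_gt0. Qed.

Lemma DC_kernel_sym : (DC_kernel t lambda rho)^T = DC_kernel t lambda rho.
Proof. by apply/matrixP=> i j; rewrite !mxE distrC [t j + t i]addrC. Qed.

(** Since [t j <= t i], the absolute value opens, and the powers can be grouped by time. *)
Let DC_gen (i j : 'I_N) : (j <= i)%N -> DC_kernel t lambda rho i j =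
  \sum_(k < 1) (lambda * rho) `^ t i * (lambda / rho) `^ t j.
Proof.
move=> /le_times le_ji; rewrite big_ord1 mxE ger0_norm ?subr_ge0 //.
rewrite !powRM ?invr_ge0 ?ltW // powRV // !powRD_gt0 // powRN.
by rewrite mulrACA.
Qed.

Lemma DC_semiseparable : (0 < N)%N -> semiseparable 1 (DC_kernel t lambda rho).
Proof.
move=> N_gt0; pose i0 := Ordinal N_gt0.
(* A single positive entry, here the top left one, is a nonzero minor of size 1. *)
apply: (semiseparable_generators DC_kernel_sym DC_gen
  (i0 := i0) (f := fun=> i0) (g := fun=> i0)) => [k|]; first by rewrite leqnn.
by rewrite det_mx11 !mxE mulf_neq0 // gt_eqF ?powR_gt0.
Qed.

Lemma DC_GvR : is_GvR (DC_kernel t lambda rho)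
  (DC_c t lambda rho) (DC_s t lambda rho) (DC_nu t lambda rho).
Proof.
apply: (GvR_generators DC_kernel_sym DC_gen
  (g := fun i _ => tail_norm t (lambda * rho) 2 i)).
- by move=> i _; rewrite gt_eqF ?tail_norm_gt0.
- by move=> i _ _; rewrite tail_norm_sqr // powR_mulnl.
- by move=> i _ iN; apply: tail_norm_last; rewrite ?powR_ge0 ?powR_mulnl.
- by move=> i k; rewrite /DC_c /with_last; case: eqP => _; rewrite !mxE.
- by move=> i k; rewrite /DC_s /with_last; case: eqP => _; rewrite !mxE.
by move=> j k; rewrite !mxE.
Qed.

End DC.

Lemma TC_kernelE (rho : R) : 0 < rho -> TC_kernel t rho = DC_kernel t rho rho.
Proof. by move=> rho_gt0; apply/matrixP=> i j; rewrite !mxE powRD_gt0. Qed.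

End Kernels.

Theorem proposition3p3 (R : realType) (N : nat) (hN : (0 < N)%N)
  (t : 'I_N -> R)
  (t_ge0 : forall i : 'I_N, i = 0%N :> nat -> 0 <= t i)
  (t_incr : forall i j : 'I_N, (i < j)%N -> t i < t j) :
  [/\ forall rho : R, 0 < rho < 1 ->
        ((3 <= N)%N -> semiseparable 2 (SS_kernel t rho)) /\
        is_GvR (SS_kernel t rho) (SS_c t rho) (SS_s t rho) (SS_nu t rho),
      forall lambda rho : R, 0 < lambda <= 1 -> 0 < rho < 1 ->
        semiseparable 1 (DC_kernel t lambda rho) /\
        is_GvR (DC_kernel t lambda rho)
          (DC_c t lambda rho) (DC_s t lambda rho) (DC_nu t lambda rho)
    & forall rho : R, 0 < rho < 1 ->
        semiseparable 1 (TC_kernel t rho) /\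
        is_GvR (TC_kernel t rho)
          (DC_c t rho rho) (DC_s t rho rho) (DC_nu t rho rho)].
Proof.
split.
- by move=> rho rho01; split; [exact: SS_semiseparable | exact: SS_GvR].
- move=> lambda rho /andP[lambda_gt0 _] /andP[rho_gt0 _].
  by split; [exact: DC_semiseparable | exact: DC_GvR].
move=> rho /andP[rho_gt0 _]; rewrite TC_kernelE //.
by split; [exact: DC_semiseparable | exact: DC_GvR].
Qed.
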